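(* Let $H>0$ be fixed and let $X=(X_t)_{t\in\mathbb{Z}}$ be a stochastic process. Then $X$ is strictly stationary if and only if $\lim_{t\to-\infty}e^{tH}X_t=0$ in probability and $$\Delta_t X=(e^{-H}-1)X_{t-1}+\Delta_t G\qquad\text{for every } t\in\mathbb{Z}$$ for a unique $G=(G_t)_{t\in\mathbb{Z}}\in\mathcal{G}_H$.
   Context: All processes are real-valued and indexed by $\mathbb{Z}$. For a process $Y=(Y_t)_{t\in\mathbb{Z}}$ write $\Delta_t Y=Y_t-Y_{t-1}$. A process $X$ is strictly stationary if $(X_{t+n_1},\ldots,X_{t+n_k})$ and $(X_{n_1},\ldots,X_{n_k})$ have the same law for all $k\in\mathbb{N}$ and $t,n_1,\ldots,n_k\in\mathbb{Z}$. A process $G$ is a strictly stationary increment process if $(\Delta_t G)_{t\in\mathbb{Z}}$ is strictly stationary. For $H>0$, $\mathcal{G}_H$ denotes the class of strictly stationary increment processes $G=(G_t)_{t\in\mathbb{Z}}$ with $G_0=0$ such that the limit $\lim_{k\to-\infty}\sum_{t=k}^{0}e^{tH}\Delta_t G$ exists in probability and defines an almost surely finite random variable. *)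

(* Defs.v *)
From mathcomp Require Import all_boot all_order all_algebra.
From mathcomp Require Import all_classical all_reals all_analysis.

Set Implicit Arguments.
Unset Strict Implicit.
Unset Printing Implicit Defensive.

Import Order.TTheory GRing.Theory Num.Theory.
Import numFieldNormedType.Exports.

Local Open Scope classical_set_scope.
Local Open Scope ring_scope.

(* A process is a family int -> {RV P >-> R}. Operations and predicates are
   stated on the underlying families of functions int -> T -> R, so that they
   apply to increments without building {RV P >-> R} structures on them.
   Equalities between random variables (the value of G at 0, the difference
   equation, the uniqueness of G) are P-almost sure equalities. *)

Section Processes.
Context {R : realType} {d : measure_display} {T : measurableType d}.
Variable P : probability T R.

Definition increment (Y : int -> T -> R) (t : int) (w : T) : R :=
  Y t w - Y (t - 1) w.

(* Laws on R^k are compared on the product (= Borel) sigma-algebra carried by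
   k.-tuple R; equality of the pushforwards as functions on all sets would also
   compare junk values on nonmeasurable sets. *)
Definition strictly_stationary (Y : int -> T -> R) : Prop :=
  forall (k : nat) (t : int) (n : 'I_k -> int) (A : set (k.-tuple R)),
    measurable A ->
    pushforward P (fun w => [tuple Y (t + n i) w | i < k]) A =
    pushforward P (fun w => [tuple Y (n i) w | i < k]) A.

Definition cvg_in_probability (U : nat -> T -> R) (Z : T -> R) : Prop :=
  forall eps : R, 0 < eps ->
    P [set w | eps <= `|U n w - Z w|] @[n --> \oo] --> 0%E.

Definition discounted (H : R) (Y : int -> T -> R) (t : int) (w : T) : R :=
  expR (t%:~R * H) * Y t w.

(* The partial sum over t = - n, ..., 0; limits along integers tending to -oo
   are taken through t = - n with n : nat tending to +oo. *)
Definition discounted_sum (H : R) (Y : int -> T -> R) (n : nat) (w : T) : R :=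
  \sum_(0 <= j < n.+1) discounted H Y (- j%:Z) w.

(* An almost surely finite limit in probability is represented by a
   real-valued random variable, to which it is almost surely equal. *)
Definition in_GH (H : R) (G : int -> {RV P >-> R}) : Prop :=
  [/\ strictly_stationary (increment (fun t => G t)),
      {ae P, forall w, G 0 w = 0} &
      exists Z : {RV P >-> R},
        cvg_in_probability (discounted_sum H (increment (fun t => G t))) Z].

Definition langevin (H : R) (X G : int -> {RV P >-> R}) : Prop :=
  forall t : int, {ae P, forall w,
    increment (fun s => X s) t w =
      (expR (- H) - 1) * X (t - 1) w + increment (fun s => G s) t w}.

End Processes.

(* Main.v *)
(* Put D_t = X_t - e^(-H) X_(t-1), which is the increment of G in the Langevin
   equation. The sums of e^(-jH) D_(t-j) over 0 <= j <= n telescope to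
   X_t - e^(-(n+1)H) X_(t-n-1), so they converge to X_t in probability as soon
   as e^(tH) X_t -> 0 at -oo. If X is stationary, so is D, and the discounted X
   vanishes because P(|X_(-n)| >= eps e^(nH)) = P(|X_0| >= eps e^(nH)).
   Conversely, stationarity of D passes to these moving averages and then to
   their limit in probability X. *)
Require Import Defs.
From mathcomp Require Import all_boot all_order all_algebra.
From mathcomp Require Import all_classical all_reals all_analysis.
From mathcomp Require Import ring lra zify measurable_realfun.
Import Order.TTheory GRing.Theory Num.Theory.
Import numFieldNormedType.Exports.
Local Open Scope classical_set_scope.
Local Open Scope ring_scope.

Set Implicit Arguments.
Unset Strict Implicit.
Unset Printing Implicit Defensive.

Section Langevin.
Context {R : realType} {d : measure_display} {T : measurableType d}.
Variable P : probability T R.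

(** * Laws of random vectors tested on lower boxes *)

Lemma le_measure_ae (A B : set T) : measurable A -> measurable B ->
  {ae P, forall w, A w -> B w} -> (P A <= P B)%E.
Proof.
move=> mA mB AB.
have mAB : measurable (A `\` B) by exact: measurableD.
have AB0 : P (A `\` B) = 0%E.
  apply: measure_negligible => //; apply: negligibleS AB => w /= [Aw nBw].
  by move/(_ Aw).
rewrite -[leRHS]adde0 -AB0; apply: (le_trans _ (measureU2 P mB mAB)).
apply: le_measure; rewrite ?inE//; first exact: measurableU.
by move=> w Aw; have [Bw|nBw] := pselect (B w); [left|right].
Qed.

Lemma measurable_mktuple (d' : measure_display) (S : measurableType d')
    (k : nat) (U : 'I_k -> S -> R) :
  (forall i, measurable_fun setT (U i)) ->
  measurable_fun setT (fun w => [tuple U i w | i < k]).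
Proof.
move=> mU; apply/measurable_fun_tnthP => i.
by apply: eq_measurable_fun (mU i) => w _ /=; rewrite tnth_mktuple.
Qed.

(* The bounds may be infinite so that the half-spaces [x_i < r] are boxes. *)
Definition lower_box (k : nat) (a : 'I_k -> \bar R) : set (k.-tuple R) :=
  [set x | forall i, ((tnth x i)%:E < a i)%E].

Lemma measurable_lower_box (k : nat) (a : 'I_k -> \bar R) :
  measurable (lower_box a).
Proof.
rewrite (_ : lower_box a =
    \bigcap_(i in [set: 'I_k]) [set x | ((tnth x i)%:E < a i)%E]); last first.
  by apply/seteqP; split=> [x xa i _|x xa i]; exact: xa.
apply: fin_bigcap_measurable => // i _; rewrite -[X in measurable X]setTI.
apply: emeasurable_fun_infty_o => //.
apply/measurable_EFinP; exact: measurable_tnth.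
Qed.

(** Coordinate preimages of the half-lines []-oo, x[] already generate the product sigma-algebra.
    Such a preimage is the box with bound [x] in one coordinate and [+oo] in all others. *)
Lemma measurable_tuple_lower_box (k : nat) :
  @measurable _ (k.-tuple R) = <<s [set lower_box a | a in setT] >>.
Proof.
apply/seteqP; split; last first.
  apply: smallest_sub; first exact: sigma_algebra_measurable.
  by move=> _ [a _ <-]; exact: measurable_lower_box.
apply: smallest_sub; first exact: smallest_sigma_algebra.
rewrite -bigcup_seq => A /= [i _ [B mB]]; rewrite setTI => <-.
suff : measurable_fun setT
   ((fun x => tnth x i) :
     g_sigma_algebraType [set lower_box a | a in setT] -> R).
  by move=> /(_ measurableT _ mB); rewrite setTI.
apply: (measurability _ (RGenInftyO.measurableE R)) => _ [_ [x ->] <-].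
apply: sub_sigma_algebra.
exists (fun j => if j == i then x%:E else +oo%E) => //.
rewrite setTI; apply/seteqP; split=> [y yx|y yx j] /=.
  by have := yx i; rewrite eqxx lte_fin in_itv.
case: eqP => [->|_]; last exact: ltry.
by move: yx; rewrite /= in_itv lte_fin.
Qed.

(** Dynkin's pi-lambda argument: boxes are stable under intersection, by taking coordinatewise
    minima of the bounds, and the sets on which two probability laws agree are stable under
    complements and countable disjoint unions. *)
Lemma eq_law_lower_box (k : nat) (U V : T -> k.-tuple R) :
  measurable_fun setT U -> measurable_fun setT V ->
  (forall a, pushforward P U (lower_box a) = pushforward P V (lower_box a)) ->
  forall A, measurable A -> pushforward P U A = pushforward P V A.
Proof.
move=> mU mV UV A; rewrite measurable_tuple_lower_box.
have mUA W : measurable W -> measurable (U @^-1` W).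
  by move=> mW; rewrite -[X in measurable X]setTI; exact: mU.
have mVA W : measurable W -> measurable (V @^-1` W).
  by move=> mW; rewrite -[X in measurable X]setTI; exact: mV.
move: A; apply: dynkin_induction.
- exact: measurable_tuple_lower_box.
- move=> _ _ [a _ <-] [b _ <-]; exists (fun i => mine (a i) (b i)) => //.
  apply/seteqP; split=> [x xab|x [xa xb] i].
    by split=> i; have := xab i; rewrite lt_min => /andP[].
  by rewrite lt_min xa xb.
- by rewrite /pushforward !preimage_setT.
- by move=> _ [a _ <-]; exact: UV.
- move=> S mS UVS; rewrite /pushforward -(preimage_setC U) -(preimage_setC V).
  rewrite (probability_setC P (mUA _ mS)) (probability_setC P (mVA _ mS)).
  by congr (1 - _)%E.
- move=> F mF tF UVF; rewrite /pushforward !preimage_bigcup.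
  have bigcupE (W : T -> k.-tuple R) :
      (forall B, measurable B -> measurable (W @^-1` B)) ->
      P (\bigcup_i (W @^-1` F i)) = (\sum_(0 <= i <oo) P (W @^-1` F i))%E.
    move=> mW; apply: measure_semi_bigcup.
    - by move=> i; exact: mW.
    - by move=> i j _ _ [w [Fi Fj]]; apply: tF => //; exists (W w).
    - by apply: bigcup_measurable => i _; exact: mW.
  by rewrite !bigcupE//; apply: eq_eseriesr => i _; exact: UVF.
Qed.

Lemma preimage_lower_box (k : nat) (U : 'I_k -> T -> R) (a : 'I_k -> \bar R) :
  (fun w => [tuple U i w | i < k]) @^-1` lower_box a =
  [set w | forall i, ((U i w)%:E < a i)%E].
Proof.
by apply/seteqP; split=> w /= Uw i; have := Uw i; rewrite tnth_mktuple.
Qed.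

Lemma measurable_lower_event (k : nat) (U : 'I_k -> T -> R) (a : 'I_k -> \bar R) :
  (forall i, measurable_fun setT (U i)) ->
  measurable [set w | forall i, ((U i w)%:E < a i)%E].
Proof.
move=> mU; rewrite -preimage_lower_box -[X in measurable X]setTI.
by apply: measurable_mktuple => //; exact: measurable_lower_box.
Qed.

(** * Box probabilities under convergence in probability *)

Lemma measurable_deviation (U V : T -> R) (e : R) :
  measurable_fun setT U -> measurable_fun setT V ->
  measurable [set w | e <= `|U w - V w|].
Proof.
move=> mU mV; rewrite -[X in measurable X]setTI.
rewrite (_ : [set w | _] = (fun w => `|U w - V w|) @^-1` `[e, +oo[%classic).
  by apply: measurableT_comp => //; exact: measurable_funB.
by apply/seteqP; split=> w /=; rewrite in_itv /= andbT.
Qed.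

Lemma le_measure_bigsetU (I : Type) (r : seq I) (F : I -> set T) :
  (forall i, measurable (F i)) ->
  (P (\big[setU/set0]_(i <- r) F i) <= \sum_(i <- r) P (F i))%E.
Proof.
move=> mF; elim: r => [|i r IH]; first by rewrite !big_nil measure0.
rewrite !big_cons; apply: (le_trans (measureU2 P _ _)) => //.
  exact: bigsetU_measurable.
exact: leeD.
Qed.

(** Outside the [k] deviation events one has [V i w < U i w + e] for every [i], so the first event
    forces the second. The exceptional set is controlled by the union bound. *)
Lemma lower_event_perturb (k : nat) (U V : 'I_k -> T -> R) (a : 'I_k -> \bar R)
    (e : R) :
  (forall i, measurable_fun setT (U i)) ->
  (forall i, measurable_fun setT (V i)) ->
  (P [set w | forall i, ((U i w + e)%:E < a i)%E] <=
   P [set w | forall i, ((V i w)%:E < a i)%E] +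
   \sum_(i < k) P [set w | (e <= `|V i w - U i w|)%R])%E.
Proof.
move=> mU mV; set A := (X in (P X <= _)%E).
set B := [set w | forall i, ((V i w)%:E < a i)%E].
pose C (i : 'I_k) := [set w | e <= `|V i w - U i w|].
have mC i : measurable (C i) by exact: measurable_deviation.
have mA : measurable A.
  by apply: measurable_lower_event => i; exact: measurable_funD.
have mB : measurable B by exact: measurable_lower_event.
have mUC : measurable (\big[setU/set0]_(i < k) C i).
  exact: bigsetU_measurable.
apply: (@le_trans _ _ (P (B `|` \big[setU/set0]_(i < k) C i))).
  apply: le_measure; rewrite ?inE//; first exact: measurableU.
  move=> w Aw; rewrite -bigcup_seq.
  have [[i Ci]|nC] := pselect (exists i, C i w).
    by right; exists i => //=; rewrite mem_index_enum.
  left=> i; apply: le_lt_trans (Aw i); rewrite lee_fin -lerBlDl ltW//.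
  rewrite ltNge; apply/negP => ei; apply: nC; exists i.
  exact: le_trans ei (ler_norm _).
apply: (le_trans (measureU2 P mB mUC)); apply: leeD => //.
exact: le_measure_bigsetU.
Qed.

(** Continuity from below: because the inequalities are strict, the shifted events increase to the
    unshifted one as the shift tends to 0. *)
Lemma cvg_lower_event (k : nat) (U : 'I_k -> T -> R) (a : 'I_k -> \bar R) :
  (forall i, measurable_fun setT (U i)) ->
  P [set w | forall i, ((U i w + n.+1%:R^-1)%:E < a i)%E] @[n --> \oo] -->
  P [set w | forall i, ((U i w)%:E < a i)%E].
Proof.
move=> mU.
rewrite (_ : [set w | forall i, ((U i w)%:E < a i)%E] =
  \bigcup_n [set w | forall i, ((U i w + n.+1%:R^-1)%:E < a i)%E]).
  apply: nondecreasing_cvg_mu.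
  - by move=> n; apply: measurable_lower_event => i; exact: measurable_funD.
  - apply: bigcupT_measurable => n.
    by apply: measurable_lower_event => i; exact: measurable_funD.
  - move=> m n mn; apply/subsetPset => w Uw i; apply: le_lt_trans (Uw i).
    by rewrite lee_fin lerD2l lef_pV2 ?posrE// ler_nat.
apply/seteqP; split=> [w Uw|w [n _ Uw] i]; last first.
  by apply: le_lt_trans (Uw i); rewrite lee_fin lerDl.
(* There are finitely many coordinates, so one [n] can serve them all. *)
suff : \forall n \near \oo, forall i, ((U i w + n.+1%:R^-1)%:E < a i)%E.
  by move=> [n _ /(_ n (leqnn n))]; exists n.
apply: filter_forall => i; have := Uw i.
case: (a i) => [r| |]; last by rewrite ltNge leNye.
- rewrite lte_fin -subr_gt0 => Ur.
  apply: filterS (near_infty_natSinv_lt (PosNum Ur)) => n.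
  by rewrite lte_fin -ltrBrDl.
- by move=> _; apply: nearW => n; exact: ltry.
Qed.

(* Comparing the boxes shifted by 1/(m+1) absorbs the deviations, so that no
   continuity point of the limit laws is needed. *)
Lemma le_lower_event_lim (k : nat) (U V : 'I_k -> T -> R)
    (Un Vn : nat -> 'I_k -> T -> R) (a : 'I_k -> \bar R) :
  (forall i, measurable_fun setT (U i)) ->
  (forall i, measurable_fun setT (V i)) ->
  (forall n i, measurable_fun setT (Un n i)) ->
  (forall n i, measurable_fun setT (Vn n i)) ->
  (forall i, cvg_in_probability P (Un ^~ i) (U i)) ->
  (forall i, cvg_in_probability P (Vn ^~ i) (V i)) ->
  (forall n b, P [set w | forall i, ((Un n i w)%:E < b i)%E] =
               P [set w | forall i, ((Vn n i w)%:E < b i)%E]) ->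
  (P [set w | forall i, ((U i w)%:E < a i)%E] <=
   P [set w | forall i, ((V i w)%:E < a i)%E])%E.
Proof.
move=> mU mV mUn mVn cU cV UVn.
have cl := @cvg_lower_event k U a mU.
refine (cvge_to_le cl _).
(* Half of the shift pays for replacing [U] by [Un n], the other half for replacing [Vn n] by
   [V]. *)
apply: nearW => m; pose e : R := m.+1%:R^-1 / 2.
have e0 : 0 < e by rewrite divr_gt0.
have sum0 (W : 'I_k -> T -> R) (Wn : nat -> 'I_k -> T -> R) :
    (forall i, cvg_in_probability P (Wn ^~ i) (W i)) ->
    (\sum_(i < k) P [set w | (e <= `|Wn n i w - W i w|)%R])%E @[n --> \oo] --> 0%E.
  move=> cW.
  have := @cvg_nnesum _ \oo _ R 'I_k (index_enum 'I_k)
    (fun i n => P [set w | e <= `|Wn n i w - W i w|]) (fun=> 0%E) xpredT.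
  rewrite [X in _ --> X]big1//; apply=> i _; last exact: cW.
  by apply: nearW => n; exact: measure_ge0.
have key n : (P [set w | forall i, ((U i w + m.+1%:R^-1)%:E < a i)%E] <=
    P [set w | forall i, ((V i w)%:E < a i)%E] +
    (\sum_(i < k) P [set w | (e <= `|Vn n i w - V i w|)%R] +
     \sum_(i < k) P [set w | (e <= `|Un n i w - U i w|)%R]))%E.
  (* The equality of laws concerns unshifted events with arbitrary bounds, so the shift is moved
     into the bound; this is sound for infinite bounds too. *)
  have shift (W : 'I_k -> T -> R) (c : R) :
      [set w | forall i, ((W i w + c)%:E < a i)%E] =
      [set w | forall i, ((W i w)%:E < a i - c%:E)%E].
    by apply/seteqP; split=> w Ww i; have := Ww i; rewrite lteBrDr.
  have -> : [set w | forall i, ((U i w + m.+1%:R^-1)%:E < a i)%E] =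
            [set w | forall i, ((U i w + e)%:E < a i - e%:E)%E].
    apply/seteqP; split=> w Uw i; have := Uw i;
      by rewrite lteBrDr// -EFinD -addrA -splitr.
  apply: (le_trans (lower_event_perturb _ e mU (mUn n))).
  rewrite UVn addeA leeD2r// -shift.
  apply: (le_trans (lower_event_perturb _ e (mVn n) mV)).
  rewrite leeD2l//; apply: lee_sum => i _.
  by under eq_set do rewrite distrC.
have fB : P [set w | forall i, ((V i w)%:E < a i)%E] \is a fin_num.
  by apply: fin_num_measure; exact: measurable_lower_event.
(* With [m] fixed, [n] tends to infinity and both deviation sums in [key] vanish. *)
refine (@cvge_to_ge _ \oo _ _ _ _ _ _ (nearW _ key)).
rewrite -[X in _ --> X]adde0; apply: cvgeD.
- exact: fin_num_adde_defr.
- exact: cvg_cst.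
- by rewrite -[X in _ --> X]adde0; apply: cvgeD => //; exact: sum0.
Qed.

(** * Operations that preserve strict stationarity *)

(** The box inequality for limits, used once in each direction between the shifted and the unshifted
    vector, gives equality on boxes and hence on all measurable sets. *)
Lemma strictly_stationary_lim (Y : nat -> int -> T -> R) (Z : int -> T -> R) :
  (forall n t, measurable_fun setT (Y n t)) ->
  (forall t, measurable_fun setT (Z t)) ->
  (forall n, strictly_stationary P (Y n)) ->
  (forall t, cvg_in_probability P (fun n => Y n t) (Z t)) ->
  strictly_stationary P Z.
Proof.
move=> mY mZ sY cY k t s A mA.
apply: eq_law_lower_box => // [||a]; try exact: measurable_mktuple.
have Yeq n b : P [set w | forall i, ((Y n (t + s i) w)%:E < b i)%E] =
               P [set w | forall i, ((Y n (s i) w)%:E < b i)%E].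
  rewrite -!preimage_lower_box; apply: sY; exact: measurable_lower_box.
rewrite /pushforward !preimage_lower_box; apply/eqP; rewrite eq_le.
apply/andP; split.
- by apply: (@le_lower_event_lim _ _ _ (fun n i => Y n (t + s i)) (fun n i => Y n (s i))) => *.
- by apply: (@le_lower_event_lim _ _ _ (fun n i => Y n (s i)) (fun n i => Y n (t + s i))) => *.
Qed.

(** The [k] values of the moving average are one measurable function [F] of [k * m] values of [Y],
    and [F] does not depend on the time shift. The pairs (time, lag) are numbered by [enum_rank] so
    that these values form a single tuple. *)
Lemma strictly_stationary_filter (Y : int -> T -> R) (m : nat) (c : 'I_m -> R)
    (s : 'I_m -> int) :
  strictly_stationary P Y ->
  strictly_stationary P (fun t w => \sum_(j < m) c j * Y (t + s j) w).
Proof.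
move=> sY k t n A mA.
pose N := #|{: 'I_k * 'I_m}|.
pose F (x : N.-tuple R) : k.-tuple R :=
  [tuple \sum_(j < m) c j * tnth x (enum_rank (i, j)) | i < k].
have mF : measurable_fun setT F.
  apply: measurable_mktuple => i; apply: measurable_sum => j.
  by apply: measurable_funM => //; exact: measurable_tnth.
have FE r : (fun w => [tuple \sum_(j < m) c j * Y (r + n i + s j) w | i < k]) =
    F \o (fun w => [tuple Y (r + (n (enum_val p).1 + s (enum_val p).2)) w | p < N]).
  apply/funext => w; apply: eq_from_tnth => i; rewrite !tnth_mktuple.
  by apply: eq_bigr => j _; rewrite tnth_mktuple enum_rankK addrA.
have FE0 : (fun w => [tuple \sum_(j < m) c j * Y (n i + s j) w | i < k]) =
    F \o (fun w => [tuple Y (n (enum_val p).1 + s (enum_val p).2) w | p < N]).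
  apply/funext => w; apply: eq_from_tnth => i; rewrite !tnth_mktuple.
  by apply: eq_bigr => j _; rewrite tnth_mktuple enum_rankK.
rewrite FE FE0 /pushforward !comp_preimage; apply: sY.
by rewrite -[X in measurable X]setTI; exact: mF.
Qed.

(** A finite-dimensional law involves only finitely many times, so the union of the exceptional sets
    is still null. *)
Lemma strictly_stationary_ae (Y Z : int -> T -> R) :
  (forall t, measurable_fun setT (Y t)) ->
  (forall t, measurable_fun setT (Z t)) ->
  (forall t, {ae P, forall w, Y t w = Z t w}) ->
  strictly_stationary P Y -> strictly_stationary P Z.
Proof.
move=> mY mZ YZ sY k t n A mA.
have E (s : 'I_k -> int) : pushforward P (fun w => [tuple Y (s i) w | i < k]) A =
    pushforward P (fun w => [tuple Z (s i) w | i < k]) A.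
  have mtup (W : int -> T -> R) : (forall t, measurable_fun setT (W t)) ->
      measurable ((fun w => [tuple W (s i) w | i < k]) @^-1` A).
    move=> mW; rewrite -[X in measurable X]setTI.
    by apply: measurable_mktuple.
  have YZs : {ae P, forall w, forall i, Y (s i) w = Z (s i) w}.
    by apply: filter_forall => i; exact: YZ.
  have tupE w : (forall i, Y (s i) w = Z (s i) w) ->
      [tuple Y (s i) w | i < k] = [tuple Z (s i) w | i < k].
    by move=> eqw; apply: eq_from_tnth => i; rewrite !tnth_mktuple.
  apply/eqP; rewrite eq_le /pushforward; apply/andP.
  by split; apply: le_measure_ae; do ?exact: mtup;
    apply: filterS YZs => w /tupE; rewrite /preimage /= => ->.
by rewrite -!E; exact: sY.
Qed.

(** * Tails, and telescoping of discounted sums *)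

(** Continuity from above: the events decrease, and their intersection is empty because [U] is
    finite everywhere. *)
Lemma cvg_tail (U : T -> R) (r : R ^nat) : measurable_fun setT U ->
  {homo r : m n / (m <= n)%N >-> m <= n} -> r @ \oo --> +oo ->
  P [set w | r n <= `|U w|] @[n --> \oo] --> 0%E.
Proof.
move=> mU r_nd r_oo.
have mE n : measurable [set w | r n <= `|U w|].
  rewrite (_ : [set w | _] = [set w | r n <= `|U w - cst 0 w|]).
    exact: measurable_deviation.
  by apply/seteqP; split=> w /=; rewrite subr0.
have cap0 : \bigcap_n [set w | r n <= `|U w|] = set0.
  apply/seteqP; split=> // w /= Uw.
  have /cvgryPgt/(_ (`|U w|)) [n _ /(_ n (leqnn n))] := r_oo.
  by rewrite ltNge (Uw n I).
rewrite -(measure0 P) -cap0; apply: nonincreasing_cvg_mu => //.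
- by apply: le_lt_trans (probability_le1 P (mE 0%N)) _; rewrite ltry.
- by rewrite cap0.
- move=> m n mn; apply/subsetPset => w; exact: le_trans (r_nd _ _ mn).
Qed.

Lemma discounted_residual_telescope (H : R) (x : int -> R) (t : int) (n : nat) :
  \sum_(j < n) expR (- j%:R * H) * (x (t - j%:Z) - expR (- H) * x (t - j%:Z - 1))
  = x t - expR (- n%:R * H) * x (t - n%:Z).
Proof.
elim: n => [|n IH]; first by rewrite big_ord0 oppr0 mul0r expR0 mul1r subr0 subrr.
rewrite big_ord_recr /= IH.
have -> : expR (- n.+1%:R * H) = expR (- n%:R * H) * expR (- H).
  by rewrite -expRD; congr expR; rewrite -natr1; ring.
have -> : t - n%:Z - 1 = t - n.+1%:Z by lia.
ring.
Qed.

Lemma cvg_discounted_residual (H : R) (X : int -> T -> R) (t : int) :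
  cvg_in_probability P (fun n => discounted H X (- n%:Z)) (cst 0) ->
  cvg_in_probability P (fun n w => \sum_(j < n.+1)
    expR (- j%:R * H) * (X (t - j%:Z) w - expR (- H) * X (t - j%:Z - 1) w)) (X t).
Proof.
move=> cX e e0.
(* The telescoped remainder involves [X] at time [t - n - 1], which is [- q n] as soon as
   [n >= |t|]; the absolute value only makes [q n] a natural number for small [n]. *)
pose q n := `|n.+1%:Z - t|%N.
have q_oo : q @ \oo --> \oo.
  apply/cvgnyPge => A; exists (A + `|t|)%N => // n /=; rewrite /q; lia.
(* Discounting at time [t - n - 1] gives the remainder multiplied by [expR (t * H)], so the
   tolerance is rescaled by that factor. *)
have e1 : 0 < e * expR (t%:~R * H) by rewrite mulr_gt0 ?expR_gt0.
have := @cvg_comp _ _ _ q _ \oo \oo _ q_oo (cX _ e1).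
apply: cvg_trans; apply: near_eq_cvg; exists (`|t|)%N => // n /= tn.
have qE : (q n)%:Z = n.+1%:Z - t by rewrite /q; lia.
congr (P _); apply/seteqP.
suff E w : `|discounted H X (- (q n)%:Z) w - cst 0 w| =
   `|\sum_(j < n.+1) expR (- j%:R * H) *
     (X (t - j%:Z) w - expR (- H) * X (t - j%:Z - 1) w) - X t w| * expR (t%:~R * H).
  by split=> w /=; rewrite E ler_pM2r ?expR_gt0.
rewrite (discounted_residual_telescope H (X^~ w)) addrAC subrr add0r subr0 normrN.
rewrite /discounted !normrM !(ger0_norm (expR_ge0 _)) mulrAC -expRD.
have -> : - (q n)%:Z = t - n.+1%:Z by rewrite qE; lia.
congr (expR _ * _); rewrite intrB -pmulrn; ring.
Qed.


(** * The increment forced by the Langevin equation *)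

Definition residual (H : R) (X : int -> T -> R) (t : int) (w : T) : R :=
  X t w - expR (- H) * X (t - 1) w.

Lemma measurable_residual (H : R) (X : int -> T -> R) (t : int) :
  (forall s, measurable_fun setT (X s)) -> measurable_fun setT (residual H X t).
Proof. by move=> mX; apply: measurable_funB => //; exact: measurable_funM. Qed.

Lemma strictly_stationary_residual (H : R) (X : int -> T -> R) :
  strictly_stationary P X -> strictly_stationary P (residual H X).
Proof.
move=> sX.
rewrite (_ : residual H X = fun t w =>
    \sum_(j < 2) (if j == ord0 then 1 else - expR (- H)) * X (t + - j%:Z) w).
  exact: strictly_stationary_filter.
apply/funext => t; apply/funext => w.
by rewrite !big_ord_recl big_ord0 /= oppr0 !addr0 mul1r mulNr.
Qed.

Lemma strictly_stationary_discounted_cvg0 (H : R) (X : int -> T -> R) : 0 < H ->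
  (forall s, measurable_fun setT (X s)) -> strictly_stationary P X ->
  cvg_in_probability P (fun n => discounted H X (- n%:Z)) (cst 0).
Proof.
move=> H0 mX sX e e0.
have E n : P [set w | e <= `|discounted H X (- n%:Z) w - cst 0 w|] =
           P [set w | e * expR (n%:R * H) <= `|X 0 w|].
  pose A := [set x : 1.-tuple R | e * expR (n%:R * H) <= `|tnth x ord0|].
  have mA : measurable A.
    rewrite -[X in measurable X]setTI.
    rewrite (_ : A = (fun x => `|tnth x ord0|) @^-1`
                     `[e * expR (n%:R * H), +oo[%classic).
      by apply: measurableT_comp => //; exact: measurable_tnth.
    by apply/seteqP; split=> x /=; rewrite in_itv /= andbT.
  (* Only the one-dimensional marginals at times [- n] and 0 are compared. *)
  have := sX 1%N (- n%:Z) (fun=> 0) A mA.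
  rewrite /pushforward /A /preimage /=.
  under eq_set do rewrite tnth_mktuple addr0.
  under [in RHS]eq_set do rewrite tnth_mktuple.
  move=> <-; congr (P _); apply/seteqP.
  suff ew w : (e <= `|discounted H X (- n%:Z) w - cst 0 w|) =
              (e * expR (n%:R * H) <= `|X (- n%:Z) w|).
    by split=> w /=; rewrite ew.
  rewrite subr0 /discounted normrM (ger0_norm (expR_ge0 _)).
  rewrite mulrNz -pmulrn mulNr expRN mulrC ler_pdivlMr ?expR_gt0//.
under eq_fun do rewrite E.
apply: cvg_tail => //.
  move=> m n mn; rewrite ler_pM2l// ler_expR ler_pM2r// ler_nat//.
apply/cvgryPge => A.
(* Since [expR (n * H) >= 1 + n * H], the threshold exceeds [e * H * n], so [n >= A / (e * H)]
   suffices. *)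
have /cvgryPge/(_ (A / (e * H))) := @cvgr_idn R.
apply: filterS => n; rewrite ler_pdivrMr ?mulr_gt0// => /le_trans; apply.
rewrite mulrCA ler_pM2l//; apply: le_trans (expR_ge1Dx _).
by rewrite lerDr.
Qed.

(** * Processes determined by their increments and their value at 0 *)

(** Summation starts from value 0 at time 0 and runs in both directions. [Negz n] stands for
    [- (n + 1)]; going down to it from 0 undoes the increments at times 0, ..., [- n], hence [n.+1]
    terms starting with [D 0]. *)
Definition primitive (D : int -> T -> R) (t : int) (w : T) : R :=
  match t with
  | Posz n => \sum_(j < n) D j.+1%:Z w
  | Negz n => - \sum_(j < n.+1) D (- j%:Z) w
  end.

Lemma increment_primitive (D : int -> T -> R) : increment (primitive D) = D.
Proof.
apply/funext => t; apply/funext => w; rewrite /increment.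
case: t => [[|n]|n].
- by rewrite (_ : 0%:Z - 1 = Negz 0)// /primitive big_ord0 big_ord1 oppr0 sub0r opprK.
- rewrite (_ : n.+1%:Z - 1 = Posz n); last by lia.
  by rewrite /primitive big_ord_recr /= addrAC subrr add0r.
- rewrite (_ : Negz n - 1 = Negz n.+1); last by lia.
  rewrite /primitive [X in _ - - X]big_ord_recr /= opprK addrA addNr add0r.
  by rewrite NegzE.
Qed.

Lemma measurable_primitive (D : int -> T -> R) (t : int) :
  (forall s, measurable_fun setT (D s)) -> measurable_fun setT (primitive D t).
Proof.
move=> mD; case: t => n; first exact: measurable_sum.
by apply: measurableT_comp => //; exact: measurable_sum.
Qed.

(** Induction away from 0 in both directions, each step discarding one more null set. This is the
    source of the uniqueness of [G]. *)
Lemma eq_ae_increment (Y Z : int -> T -> R) :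
  {ae P, forall w, Y 0 w = Z 0 w} ->
  (forall t, {ae P, forall w, increment Y t w = increment Z t w}) ->
  forall t, {ae P, forall w, Y t w = Z t w}.
Proof.
move=> YZ0 YZ; elim/int_ind => [//|n IH|n IH].
  apply: filterS2 IH (YZ n.+1) => w; rewrite /increment.
  rewrite (_ : n.+1%:Z - 1 = n); last by lia.
  by move=> -> /addIr.
apply: filterS2 IH (YZ (- n%:Z)) => w; rewrite /increment.
rewrite (_ : - n%:Z - 1 = - n.+1%:Z); last by lia.
by move=> -> /addrI /oppr_inj.
Qed.

Lemma langevin_increment (H : R) (X G : int -> {RV P >-> R}) : langevin H X G ->
  forall t, {ae P, forall w,
    increment (fun s => G s) t w = residual H (fun s => X s) t w}.
Proof.
move=> XG t; apply: filterS (XG t) => w; rewrite /increment /residual => XGw.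
lra.
Qed.

End Langevin.

Theorem theorem1 (R : realType) (d : measure_display) (T : measurableType d)
    (P : probability T R) (H : R) (hH : 0 < H) (X : int -> {RV P >-> R}) :
  strictly_stationary P (fun t => X t) <->
  cvg_in_probability P (fun n => discounted H (fun t => X t) (- n%:Z)) (cst 0) /\
  exists G : int -> {RV P >-> R},
    [/\ in_GH H G,
        langevin H X G &
        forall G' : int -> {RV P >-> R}, in_GH H G' -> langevin H X G' ->
          forall t : int, {ae P, forall w, G' t w = G t w}].
Proof.
have mX t : measurable_fun setT (X t) by [].
have mD t : measurable_fun setT (residual H (fun s => X s) t).
  exact: measurable_residual.
split=> [sX|[cX [G [[sG _ _] XG _]]]].
  have cX := strictly_stationary_discounted_cvg0 hH mX sX.
  (* The equation dictates the increments of [G], and [G] must vanish at 0, so the primitive of the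
     residual is the only candidate. *)
  split=> //; pose F := primitive (residual H (fun s => X s)).
  have mF t : measurable_fun setT (F t) by exact: measurable_primitive.
  pose G t : {RV P >-> R} := mfun_Sub (mem_set (mF t)).
  have incG : increment (fun t => G t) = residual H (fun s => X s).
    exact: increment_primitive.
  have G0 w : G 0 w = 0 by exact: big_ord0.
  have XG : langevin H X G.
    by move=> t; apply: aeW => w; rewrite incG /increment /residual; ring.
  exists G; split=> //.
    split; first by rewrite incG; exact: strictly_stationary_residual.
      exact: aeW.
    (* The discounted sum of the increments of [G] is the telescoping sum at [t = 0], whose limit is
       [X 0]. *)
    exists (X 0) => e e0.
    have := cvg_discounted_residual 0 cX e0.
    apply: cvg_trans; apply: near_eq_cvg; apply: nearW => n /=.
    congr (P _); apply/seteqP.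
    suff E w : discounted_sum H (increment (fun t => G t)) n w =
        \sum_(j < n.+1) expR (- j%:R * H) *
          (X (0 - j%:Z) w - expR (- H) * X (0 - j%:Z - 1) w).
      by split=> w /=; rewrite E.
    rewrite /discounted_sum big_mkord incG; apply: eq_bigr => j _.
    by rewrite /discounted mulrNz sub0r.
  (* Any competitor vanishes at 0 and has the residual as increment, almost surely, as [G] does. *)
  move=> G' [_ G'0 _] XG'; apply: eq_ae_increment.
    by apply: filterS G'0 => w ->; rewrite G0.
  by move=> t; rewrite incG; exact: langevin_increment.
(* Here the residual is only almost surely equal to the stationary increments of [G]. *)
have sD : strictly_stationary P (residual H (fun s => X s)).
  apply: strictly_stationary_ae (langevin_increment XG) sG => // t.
  exact: measurable_funB.
(* For each [n] this is a finite moving average of the residual with lags [- j], hence stationary,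
   and it converges to [X t] in probability. *)
apply: (strictly_stationary_lim (Y := fun n t w => \sum_(j < n.+1)
    expR (- j%:R * H) * residual H (fun s => X s) (t + - j%:Z) w)) => //.
- by move=> n t; apply: measurable_sum => j; exact: measurable_funM.
- by move=> n; exact: strictly_stationary_filter.
- by move=> t; exact: cvg_discounted_residual.
Qed.
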